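(* Let $k$ be any field and let $X$ be any nonempty set. Then the following hold. (i) $Z$ is a maximal $T$-ideal of $k\langle X\rangle_0$, and if $k$ is infinite, then $Z$ is the maximum $T$-ideal of $k\langle X\rangle_0$. If $k$ is finite of order $q$, then $k\langle X\rangle_0$ has exactly one other maximal $T$-ideal, namely $W_0=T^{(2)}+\{x-x^q\}^T$ (where $x\in X$). (ii) Every maximal $T$-ideal of $k\langle X\rangle_0$ is a maximal $T$-space of $k\langle X\rangle_0$. (iii) If $k$ is infinite, then $Z$ is the only maximal $T$-space of $k\langle X\rangle_0$. (iv) If $k$ is finite, then $k\langle X\rangle_0$ has infinitely many maximal $T$-spaces.
   Context: $k\langle X\rangle_0$ denotes the free (nonunitary) associative $k$-algebra on the set $X$ (it has as $k$-basis the nonempty words in $X$). For an associative $k$-algebra $A$, a $T$-space of $A$ is a $k$-linear subspace of $A$ that is invariant under every $k$-algebra endomorphism of $A$; a $T$-ideal of $A$ is a $T$-space of $A$ that is also a (two-sided) ideal of $A$. For $H\subseteq A$, $H^T$ denotes the smallest $T$-ideal of $A$ containing $H$. ''Maximal'' $T$-spaces (respectively $T$-ideals) are the maximal elements, under inclusion, among the proper $T$-spaces (respectively proper $T$-ideals); the ''maximum'' $T$-ideal means a proper $T$-ideal containing every proper $T$-ideal. $Z$ denotes the following $T$-ideal of $k\langle X\rangle_0$: if $|X|>1$, $Z=\{xy\}^T$ where $x,y\in X$ are distinct; if $X=\{x\}$, $Z=\{x^2\}^T$. $T^{(2)}$ denotes the following $T$-ideal of $k\langle X\rangle_0$: if $|X|=1$,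 $T^{(2)}=\{0\}$; if $|X|>1$, $T^{(2)}=\{[x,y]\}^T$ where $x,y\in X$ are distinct and $[x,y]=xy-yx$. *)

(* Defs.v *)
From HB Require Import structures.
From mathcomp Require Import all_boot all_order all_algebra.
From mathcomp Require Import boolp classical_sets functions cardinality.
From mathcomp Require Import monalg.

Set Implicit Arguments.
Unset Strict Implicit.
Unset Printing Implicit Defensive.

Import GRing.Theory.
Local Open Scope classical_set_scope.
Local Open Scope ring_scope.

(* Associative algebras over a field, not necessarily unitary (MathComp's
   [algType] has a unit). *)
HB.mixin Record Lmodule_isNuAlgebra (k : fieldType) A of GRing.Lmodule k A := {
  numul : A -> A -> A;
  numulA : associative numul;
  numulDl : left_distributive numul +%R;
  numulDr : right_distributive numul +%R;
  nuscaleAl : forall (a : k) (u v : A), a *: numul u v = numul (a *: u) v;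
  nuscaleAr : forall (a : k) (u v : A), a *: numul u v = numul u (a *: v)
}.

#[short(type="nuAlgType")]
HB.structure Definition NuAlgebra (k : fieldType) :=
  {A of GRing.Lmodule k A & Lmodule_isNuAlgebra k A}.

Declare Scope nualg_scope.
Delimit Scope nualg_scope with nualg.
Infix "**" := numul (at level 40, left associativity) : nualg_scope.
Local Open Scope nualg_scope.

Section NuAlgebraTheory.
Variables (k : fieldType) (A : nuAlgType k).
Implicit Types (S H : set A) (f : A -> A).

(* [u ** ... ** u] with [n] factors; only meaningful for [0 < n], since [A]
   need not have a unit (the value at [n = 0] is the junk value [0]). *)
Definition nuexp (u : A) (n : nat) : A := iterop n (@numul k A) u 0.

Definition nucomm (u v : A) : A := u ** v - v ** u.

Definition alg_endo f : Prop :=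
  (forall (a : k) (u v : A), f (a *: u + v) = a *: f u + f v) /\
  (forall u v : A, f (u ** v) = f u ** f v).

Definition subspace S : Prop :=
  S 0 /\ forall (a : k) (u v : A), S u -> S v -> S (a *: u + v).

Definition two_sided_ideal S : Prop :=
  subspace S /\ forall u v : A, S u -> S (u ** v) /\ S (v ** u).

Definition Tspace S : Prop :=
  subspace S /\ forall f, alg_endo f -> f @` S `<=` S.

Definition Tideal S : Prop := Tspace S /\ two_sided_ideal S.

Definition Tideal_gen H : set A := smallest Tideal H.

Definition set_add (S1 S2 : set A) : set A :=
  [set u + v | u in S1 & v in S2].

End NuAlgebraTheory.

Section Maximality.
Variables (T : Type) (P : set T -> Prop).

Definition proper_among (M : set T) : Prop := P M /\ M <> setT.

Definition maximal_among (M : set T) : Prop :=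
  proper_among M /\
  forall N : set T, proper_among N -> M `<=` N -> N = M.

Definition maximum_among (M : set T) : Prop :=
  proper_among M /\ forall N : set T, proper_among N -> N `<=` M.

End Maximality.

Definition maximal_Tspace (k : fieldType) (A : nuAlgType k) : set (set A) :=
  maximal_among (@Tspace k A).
Definition maximal_Tideal (k : fieldType) (A : nuAlgType k) : set (set A) :=
  maximal_among (@Tideal k A).
Definition maximum_Tideal (k : fieldType) (A : nuAlgType k) : set (set A) :=
  maximum_among (@Tideal k A).

(* The unitary free algebra is the monoid algebra [{malg k[{fmonom X}]}] of the
   free monoid on [X]; the nonunitary one consists of the elements whose
   coefficient at the empty word vanishes, i.e. the span of the nonempty
   words. *)
Section FreeAlgebra.
Variables (k : fieldType) (X : choiceType).
Local Notation kX := {malg k[{fmonom X}]}.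

Definition no_const : {pred kX} := [pred p : kX | p@_(mone) == 0].

Fact no_const_submod : submod_closed no_const.
Proof.
split=> [|a p q]; first by rewrite inE mcoeff0.
by rewrite !inE => /eqP p0 /eqP q0; rewrite mcoeffD mcoeffZ p0 q0 mulr0 addr0.
Qed.
HB.instance Definition _ :=
  GRing.isSubmodClosed.Build k kX no_const no_const_submod.

Record freealg0 := FreeAlg0 {
  freealg0_val :> kX;
  freealg0P : freealg0_val \in no_const
}.
HB.instance Definition _ := [isSub for freealg0_val].
HB.instance Definition _ := [Choice of freealg0 by <:].
HB.instance Definition _ := [SubChoice_isSubLmodule of freealg0 by <:].

Fact freealg0_mul_subproof (p q : freealg0) :
  (p : kX) * (q : kX) \in no_const.
Proof.
by rewrite inE rmorphM /= (eqP (freealg0P p)) mul0r.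
Qed.

Definition freealg0_mul (p q : freealg0) : freealg0 :=
  FreeAlg0 (freealg0_mul_subproof p q).

Fact freealg0_mulA : associative freealg0_mul.
Proof. by move=> p q r; apply/val_inj; rewrite /= mulrA. Qed.

Fact freealg0_mulDl : left_distributive freealg0_mul +%R.
Proof. by move=> p q r; apply/val_inj; rewrite /= mulrDl. Qed.

Fact freealg0_mulDr : right_distributive freealg0_mul +%R.
Proof. by move=> p q r; apply/val_inj; rewrite /= mulrDr. Qed.

Fact freealg0_scaleAl (a : k) p q :
  a *: freealg0_mul p q = freealg0_mul (a *: p) q.
Proof. by apply/val_inj; rewrite /= scalerAl. Qed.

Fact freealg0_scaleAr (a : k) p q :
  a *: freealg0_mul p q = freealg0_mul p (a *: q).
Proof.
apply/val_inj/malgP => m /=; rewrite mcoeffZ.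
rewrite (mcoeffMlw m (finmap.fsubset_refl _) (finmap.fsubset_refl _)).
rewrite (mcoeffMlw m (finmap.fsubset_refl _) (msuppZ_le a _)) mulr_sumr.
apply: eq_bigr => m1 _; rewrite mulr_sumr; apply: eq_bigr => m2 _.
by rewrite mcoeffZ mulrnAr mulrCA.
Qed.

HB.instance Definition _ := Lmodule_isNuAlgebra.Build k freealg0
  freealg0_mulA freealg0_mulDl freealg0_mulDr freealg0_scaleAl freealg0_scaleAr.

Fact letter_subproof (x : X) : (<< fmu x >> : kX) \in no_const.
Proof. by rewrite inE mcoeffU1 -(inj_eq val_inj) /= fm1 fmuE. Qed.

Definition letter (x : X) : freealg0 := FreeAlg0 (letter_subproof x).

(* Several letters may be used to define each of these T-ideals; the predicates
   hold of the T-ideal obtained from any admissible choice. *)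
Definition is_Z (Z : set freealg0) : Prop :=
  (exists x y : X, x <> y /\ Z = Tideal_gen [set letter x ** letter y]) \/
  (exists x : X, [set: X] = [set x] /\
     Z = Tideal_gen [set letter x ** letter x]).

Definition is_T2 (T2 : set freealg0) : Prop :=
  (exists x : X, [set: X] = [set x] /\ T2 = [set 0]) \/
  (exists x y : X, x <> y /\
     T2 = Tideal_gen [set nucomm (letter x) (letter y)]).

Lemma set1_or_distinct : [set: X] !=set0 ->
  (exists x : X, [set: X] = [set x]) \/ (exists x y : X, x <> y).
Proof.
move=> [x _]; have [h|h] := pselect (exists y : X, x <> y).
  by right; exists x.
left; exists x; apply/seteqP; split=> // y _ /=; apply: contrapT => yx.
by apply: h; exists y => xy; apply: yx.
Qed.

Lemma is_Z_exists : [set: X] !=set0 -> exists Z, is_Z Z.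
Proof.
move=> /set1_or_distinct[[x Xx]|[x [y xy]]]; eexists.
  by right; exists x.
by left; exists x, y.
Qed.

Lemma is_T2_exists : [set: X] !=set0 -> exists T2, is_T2 T2.
Proof.
move=> /set1_or_distinct[[x Xx]|[x [y xy]]]; eexists.
  by left; exists x.
by right; exists x, y.
Qed.

End FreeAlgebra.

Arguments letter {k X} x.

(* Main.v *)
Require Import Defs.
From HB Require Import structures.
From mathcomp Require Import all_boot all_order all_algebra.
From mathcomp Require Import finfield.
From mathcomp Require Import boolp classical_sets functions cardinality.
From mathcomp Require Import monalg ring.

(** Write [A] for the free nonunitary algebra and [x] for one of its letters. A
    T-space of [A] that contains [x] is all of [A], so everything reduces to
    forcing [x] into a T-space. Sending each letter to a polynomial in [x]
    without constant term ([Tspace_onevar]) turns an element of a T-space into a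
    polynomial [h] in [x] that still lies in it, which makes most of the proof a
    matter of polynomials in one variable.

    Two T-ideals matter: [no_linear], the elements without linear part, which is
    [Z] ([is_Z_no_linear]), and [vanishing], the elements that are zero at all
    points with coordinates in [k]. For [k] finite of order [q] the latter is
    [W0] ([W0_vanishing]): modulo [W0] the algebra is commutative and satisfies
    [u^q = u], and a Zorn argument yields a homomorphism to [k] that does not
    kill a prescribed nonzero element ([point_separation]).

    A T-space with an element outside [no_linear] contains some [h] with nonzero
    linear coefficient. This makes [no_linear] maximal even among T-spaces, as
    the terms of higher degree can be subtracted; for infinite [k] one can split
    [h] into homogeneous components and reach [x] from [h] alone
    ([linear_part_infinite]). A T-space with an element outside [vanishing]
    contains some [h] with [h(1) <> 0]; over a finite field, interpolation then
    makes [vanishing] maximal among T-spaces ([nonvanishing_part_finite]).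
    Finally a T-ideal contained in neither of the two contains both kinds of
    polynomials, and a substitution combines them to give [x]
    ([linear_part_ideal]). So every proper T-ideal lies in one of the two,
    which settles the classification of maximal T-ideals.

    For the infinitude of maximal T-spaces over a finite field of characteristic
    [p], let [V_n] be the set of elements all of whose values in
    [k[T] / (T^(q^n) - T)], a substitute for the field of order [q^n], have
    trace zero. It is a T-space, and it is proper because the trace polynomial
    has degree [q^(n-1)]. For [m < n] distinct powers of [p], the trace from
    degree [n] vanishes on the elements fixed by the [q^m]-power map, and this
    yields a decomposition of [x] as a sum of an element of [V_m] and one of
    [V_n] ([trace_zero_span]). So maximal T-spaces above the different
    [V_(p^j)], given by Zorn's lemma, are all distinct. *)

Set Implicit Arguments.
Unset Strict Implicit.
Unset Printing Implicit Defensive.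

Import GRing.Theory.
Local Open Scope classical_set_scope.
Local Open Scope card_scope.
Local Open Scope ring_scope.
Local Open Scope nualg_scope.

(** * Nonunitary algebras and their homomorphisms *)
Section NuAlg.
Variables (k : fieldType) (A : nuAlgType k).
Implicit Types (S M : set A) (u v w : A).

(** Homomorphisms to the nonunitary algebra underlying [R]. The points of the
    free algebra with coordinates in [k] are its homomorphisms to the regular
    algebra [k^o]. *)
Definition alg_hom (R : algType k) (phi : A -> R) : Prop :=
  (forall (a : k) u v, phi (a *: u + v) = a *: phi u + phi v) /\
  (forall u v, phi (u ** v) = phi u * phi v).

Lemma subspace0 S : subspace S -> S 0. Proof. by case. Qed.

Lemma subspaceD S u v : subspace S -> S u -> S v -> S (u + v).
Proof. by move=> [_ h] Su Sv; rewrite -[u]scale1r; apply: h. Qed.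

Lemma subspaceZ S a u : subspace S -> S u -> S (a *: u).
Proof. by move=> [S0 h] Su; rewrite -[_ *: _]addr0; apply: h. Qed.

Lemma subspaceB S u v : subspace S -> S u -> S v -> S (u - v).
Proof.
by move=> sS Su Sv; apply: subspaceD => //; rewrite -scaleN1r; apply: subspaceZ.
Qed.

Lemma subspace_sum S (I : eqType) (r : seq I) (F : I -> A) :
  subspace S -> (forall i, i \in r -> S (F i)) -> S (\sum_(i <- r) F i).
Proof.
move=> sS SF; rewrite big_seq; elim/big_ind: _ => //.
- exact: subspace0.
- by move=> u v; apply: subspaceD.
Qed.

Lemma numul0 u : u ** 0 = 0.
Proof. by apply: (addIr (u ** 0)); rewrite -numulDr !add0r. Qed.

Lemma nu0mul u : 0 ** u = 0.
Proof. by apply: (addIr (0 ** u)); rewrite -numulDl !add0r. Qed.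

Lemma numulBl u v w : (u - v) ** w = u ** w - v ** w.
Proof. by rewrite numulDl -scaleN1r -nuscaleAl scaleN1r. Qed.

Lemma numulBr u v w : u ** (v - w) = u ** v - u ** w.
Proof. by rewrite numulDr -[- w]scaleN1r -nuscaleAr scaleN1r. Qed.

Section AlgHom.
Variables (R : algType k) (phi : A -> R) (phiP : alg_hom phi).

Lemma alg_hom0 : phi 0 = 0.
Proof. by have := phiP.1 (-1) 0 0; rewrite scaler0 add0r scaleN1r addNr. Qed.

Lemma alg_homD u v : phi (u + v) = phi u + phi v.
Proof. by rewrite -[u]scale1r phiP.1 !scale1r. Qed.

Lemma alg_homZ a u : phi (a *: u) = a *: phi u.
Proof. by rewrite -[_ *: u]addr0 phiP.1 alg_hom0 addr0. Qed.

Lemma alg_homB u v : phi (u - v) = phi u - phi v.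
Proof. by rewrite alg_homD -scaleN1r alg_homZ scaleN1r. Qed.

Lemma alg_homM u v : phi (u ** v) = phi u * phi v.
Proof. exact: phiP.2. Qed.

Lemma alg_hom_nuexp u n : (0 < n)%N -> phi (nuexp u n) = phi u ^+ n.
Proof.
case: n => // n _; rewrite /nuexp iteropS.
by elim: n => [|n IHn] /=; rewrite ?expr1 // alg_homM IHn -exprS.
Qed.

Lemma alg_hom_endo f : alg_endo f -> alg_hom (phi \o f).
Proof.
by move=> [fP fM]; split=> [a u v|u v] /=; rewrite ?fP ?fM ?phiP.1 ?alg_homM.
Qed.
End AlgHom.

Lemma Tspace_endo M f u : Tspace M -> alg_endo f -> M u -> M (f u).
Proof. by move=> [_ h] fP Mu; apply: (h _ fP); exists u. Qed.

End NuAlg.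

(** * The free algebra and its universal property *)
Lemma malg_scalerAr (k : fieldType) (K : monomType) (a : k)
  (p q : {malg k[K]}) : a *: (p * q) = p * (a *: q).
Proof.
have UC (c : k) (m : K) : << c *g m >> * a%:MP = a *: << c *g m >>.
  by rewrite -mul_malgC !malgM_def !fgmulUU mulm1 mul1m mulrC.
rewrite -[a *: q]mul_malgC mulrA -[a *: _]mul_malgC mulrA; congr (_ * _).
rewrite mul_malgC (monalgE p) mulr_suml scaler_sumr.
by apply: eq_bigr => m _; rewrite UC.
Qed.

Lemma scale_malgU (k : fieldType) (K : monomType) (c : k) (m : K) :
  c *: << m >> = << c *g m >> :> {malg k[K]}.
Proof. by apply/malgP => w; rewrite mcoeffZ !mcoeffU mulrnAr mulr1. Qed.

Lemma mcoeff_mone_M (k : fieldType) (K : monomType) (p q : {malg k[K]}) :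
  (p * q)@_mone = p@_mone * q@_mone.
Proof. exact: rmorphM. Qed.

(** The unitary free algebra, under a name of its own: the monoid algebras of
    commutative monoids already own the algebra structure of [malg]. *)
Definition freealg1 (k : fieldType) (X : choiceType) : Type :=
  {malg k[{fmonom X}]}.
HB.instance Definition _ (k : fieldType) (X : choiceType) :=
  GRing.Lalgebra.on (freealg1 k X).

HB.instance Definition _ (k : fieldType) (X : choiceType) :=
  GRing.Lalgebra_isAlgebra.Build k (freealg1 k X)
    (@malg_scalerAr k _).

Section FreeAlg.
Variables (k : fieldType) (X : choiceType).
Local Notation kX := (freealg1 k X).
Local Notation A := (freealg0 k X).

Lemma val_alg_hom : alg_hom (fun u : A => (u : kX)).
Proof. by []. Qed.

Fixpoint nuword (x : X) (s : seq X) : A :=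
  if s is y :: s' then letter x ** nuword y s' else letter x.

Lemma val_nuword x s : (nuword x s : kX) = << FMonom (x :: s) >>.
Proof.
elim: s x => [|y s IHs] x /=; first by rewrite fmuE.
rewrite IHs malgM_def fgmulUU mulr1; congr << _ *g _ >>.
by apply/eqP; rewrite fmP fmM fmuE.
Qed.

Lemma freealg0_const (u : A) : (u : kX)@_mone = 0.
Proof. exact/eqP/(freealg0P u). Qed.

(** The value at the empty word, which has no counterpart in the nonunitary
    algebra, is a dummy. *)
Definition nuword_of (w : {fmonom X}) : A :=
  if fmonom_val w is x :: s then nuword x s else 0.

Lemma freealg0_expand (u : A) :
  u = \sum_(w <- finmap.enum_fset (msupp (u : kX))) (u : kX)@_w *: nuword_of w.
Proof.
apply: val_inj; rewrite /= [LHS]monalgE.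
rewrite (big_morph (fun u : A => (u : kX)) (id1 := 0) (op1 := +%R)) //.
rewrite big_seq [RHS]big_seq; apply: eq_bigr => -[[|x s]] /= wu.
  by move: wu; rewrite -mcoeff_neq0 -fmoneE freealg0_const eqxx.
by rewrite val_nuword; exact/esym/scale_malgU.
Qed.

(** Every word is a letter followed by a shorter word, so a subspace that
    contains the letters and absorbs left multiplication by letters contains
    all words. *)
Lemma freealg0_ind (S : set A) : subspace S -> (forall x, S (letter x)) ->
  (forall x u, S u -> S (letter x ** u)) -> forall u, S u.
Proof.
move=> sS Sl Sm u.
have Sw x s : S (nuword x s) by elim: s x => [|y s IHs] x //=; apply: Sm.
rewrite (freealg0_expand u).
apply: subspace_sum => // -[[|x s]] /= _; apply: subspaceZ => //.
  exact: subspace0.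
exact: Sw.
Qed.

(** Both factors only involve nonempty words, so their product only involves
    words of length at least two. *)
Lemma mcoeff_fmu_mul (u v : A) y : (u ** v : kX)@_(fmu y) = 0.
Proof.
have nz (w : A) m : (w : kX)@_m != 0 -> (0 < size m)%N.
  rewrite lt0n; apply: contra => m0.
  by rewrite (@fdeg_eq0I _ m) ?freealg0_const //; apply/eqP.
apply/eqP; rewrite mcoeff_eq0; apply/negP => /msuppM_le[m1 [m2 []]].
rewrite -!mcoeff_neq0 => /nz m1u /nz m2v /(congr1 (@fdeg X)).
by rewrite fdegU fdegM !fdegE => e; have := leq_add m1u m2v; rewrite -e.
Qed.

Lemma alg_hom_ext (R : algType k) (phi psi : A -> R) :
  alg_hom phi -> alg_hom psi -> (forall x, phi (letter x) = psi (letter x)) ->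
  phi =1 psi.
Proof.
move=> phiP psiP e; apply: freealg0_ind => //.
- split; first by rewrite /= !alg_hom0.
  by move=> a u v /= eu ev; rewrite phiP.1 psiP.1 eu ev.
- by move=> x u eu; rewrite !alg_homM // eu e.
Qed.

Section Eval.
Variables (R : algType k) (v : X -> R).

Definition monom_eval (w : {fmonom X}) : R := \prod_(x <- w) v x.

Lemma monom_eval_mmorph : mmorphism monom_eval.
Proof.
split=> [w1 w2|]; rewrite /monom_eval ?fm1 ?big_nil //.
by rewrite fmM big_cat.
Qed.
HB.instance Definition _ :=
  isMultiplicative.Build {fmonom X} R monom_eval monom_eval_mmorph.

Definition free_eval (u : A) : R := mmap (in_alg R) monom_eval u.

Lemma free_eval_hom : alg_hom free_eval.
Proof.
split=> [a f g|f g]; rewrite /free_eval /=.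
  by rewrite raddfD /= mmapZ /= mulr_algl.
apply: (commr_mmap_is_multiplicative _).1 => h m m'.
by rewrite /GRing.comm /= mulr_algl mulr_algr.
Qed.

Lemma free_eval_letter x : free_eval (letter x) = v x.
Proof.
by rewrite /free_eval /= mmapU /= scale1r mul1r /monom_eval fmuE /= big_seq1.
Qed.
End Eval.

Lemma free_eval_unique (R : algType k) (phi : A -> R) : alg_hom phi ->
  phi =1 free_eval (phi \o letter).
Proof.
move=> phiP; apply: alg_hom_ext => //; first exact: free_eval_hom.
by move=> x; rewrite free_eval_letter.
Qed.

Lemma no_const_free_eval (v : X -> A) (u : A) :
  free_eval (fun x => v x : kX) u \in @no_const k X.
Proof.
have vP := free_eval_hom (fun x => v x : kX).
pose c (f : A) : k^o := (free_eval (fun x => v x : kX) f)@_mone.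
suff /(_ u) cu : c =1 (fun=> 0) by apply/eqP; exact: cu.
apply: alg_hom_ext.
- split=> [a f g|f g]; rewrite /c.
    rewrite vP.1; apply: etrans (mcoeffD _ _ _) _.
    by congr (_ + _); exact: mcoeffZ.
  by rewrite vP.2; exact: mcoeff_mone_M.
- by split=> *; rewrite ?scaler0 ?addr0 ?mul0r.
- by move=> x; rewrite /c free_eval_letter; exact: freealg0_const.
Qed.

Definition free_subst (v : X -> A) (u : A) : A :=
  FreeAlg0 (no_const_free_eval v u).

Lemma free_subst_endo v : alg_endo (free_subst v).
Proof.
have phiP := free_eval_hom (fun x => v x : kX).
by split=> [a f g|f g]; apply: val_inj; rewrite /= ?phiP.1 ?phiP.2.
Qed.

Lemma free_subst_letter v x : free_subst v (letter x) = v x.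
Proof. by apply: val_inj; rewrite /= free_eval_letter. Qed.

End FreeAlg.

(** * Polynomials in one element of the free algebra *)
Lemma horner_algP (k : fieldType) (R : algType k) (w : R) (a : k)
    (r s : {poly k}) :
  horner_alg w (a *: r + s) = a *: horner_alg w r + horner_alg w s.
Proof. by rewrite -mul_polyC rmorphD rmorphM /= horner_algC mulr_algl. Qed.

Lemma alg_hom_horner (k : fieldType) (A : nuAlgType k) (R : algType k)
    (phi : A -> {poly k}) (w : R) :
  alg_hom phi -> alg_hom (horner_alg w \o phi).
Proof.
move=> phiP; split=> [a u v|u v] /=; first by rewrite phiP.1 horner_algP.
by rewrite phiP.2 rmorphM.
Qed.

Lemma horner_alg_poly (k : fieldType) (p r : {poly k}) :
  horner_alg (p : {poly k}) r = r \Po p.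
Proof.
elim/poly_ind: r => [|r c IHr]; first by rewrite rmorph0 comp_poly0.
rewrite comp_poly_MXaddC rmorphD rmorphM /= IHr horner_algX horner_algC.
by rewrite alg_polyC.
Qed.

Lemma horner_alg_regular (k : fieldType) (a : k) (r : {poly k}) :
  horner_alg (a : k^o) r = r.[a].
Proof.
elim/poly_ind: r => [|r c IHr]; first by rewrite rmorph0 horner0.
rewrite rmorphD rmorphM /= IHr horner_algX horner_algC hornerMXaddC.
by congr (_ + _); exact: mulr1.
Qed.

Lemma poly_root0 (k : fieldType) (r : {poly k}) :
  r.[0] = 0 -> exists s, r = s * 'X.
Proof.
by move/eqP/factor_theorem => [s ->]; exists s; rewrite subr0.
Qed.

Section OneVariable.
Variables (k : fieldType) (X : choiceType).
Local Notation kX := (freealg1 k X).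
Local Notation A := (freealg0 k X).
Implicit Types (u : A) (r s p : {poly k}).

(** [r - r(0)] is a multiple of the variable, so its value at an element without
    constant term has no constant term either. *)
Lemma nupoly_no_const u r :
  horner_alg (u : kX) (r - r.[0]%:P) \in @no_const k X.
Proof.
have [|s ->] := @poly_root0 _ (r - r.[0]%:P).
  by rewrite hornerD hornerN hornerC subrr.
rewrite rmorphM /= horner_algX; apply/eqP.
by apply: etrans (mcoeff_mone_M _ _) _; rewrite freealg0_const mulr0.
Qed.

(** The value [r(u) - r(0)]: dropping the constant term makes this linear in [r]
    on all polynomials, with no side condition. *)
Definition nupoly u r : A := FreeAlg0 (nupoly_no_const u r).

Lemma nupoly_linear u a r s :
  nupoly u (a *: r + s) = a *: nupoly u r + nupoly u s.
Proof.
apply: val_inj; rewrite /=.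
have -> : a *: r + s - (a *: r + s).[0]%:P =
    a *: (r - r.[0]%:P) + (s - s.[0]%:P).
  rewrite hornerD hornerZ scalerBr polyCD opprD -!addrA; congr (_ + _).
  by rewrite addrCA scale_polyC.
by rewrite horner_algP; congr (_ + _).
Qed.

Lemma nupolyC u c : nupoly u c%:P = 0.
Proof. by apply: val_inj; rewrite /= hornerC subrr rmorph0. Qed.

Lemma nupolyD u r s : nupoly u (r + s) = nupoly u r + nupoly u s.
Proof. by rewrite -[r]scale1r nupoly_linear !scale1r. Qed.

Lemma nupolyZ u a r : nupoly u (a *: r) = a *: nupoly u r.
Proof. by rewrite -[a *: r]addr0 nupoly_linear -polyC0 nupolyC addr0. Qed.

Lemma nupolyB u r s : nupoly u (r - s) = nupoly u r - nupoly u s.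
Proof. by rewrite nupolyD -scaleN1r nupolyZ scaleN1r. Qed.

Lemma nupolyX u : nupoly u 'X = u.
Proof. by apply: val_inj; rewrite /= hornerX subr0 horner_algX. Qed.

Lemma nupolyM u r s : r.[0] = 0 -> s.[0] = 0 ->
  nupoly u (r * s) = nupoly u r ** nupoly u s.
Proof.
move=> r0 s0; apply: val_inj.
by rewrite /= hornerM r0 s0 mulr0 !subr0 rmorphM.
Qed.

Lemma alg_hom_nupoly (R : algType k) (phi : A -> R) u r : alg_hom phi ->
  r.[0] = 0 -> phi (nupoly u r) = horner_alg (phi u) r.
Proof.
move=> phiP /poly_root0[s ->]; elim/poly_ind: s => [|s c IHs].
  by rewrite mul0r rmorph0 -polyC0 nupolyC alg_hom0.
rewrite mulrDl nupolyD alg_homD // nupolyM ?hornerMX ?mulr0 ?hornerX //.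
rewrite alg_homM // IHs nupolyX mul_polyC nupolyZ nupolyX alg_homZ //.
by rewrite [_ + c *: _ in RHS]addrC horner_algP !rmorphM /= !horner_algX addrC.
Qed.

Lemma ideal_nupoly (M : set A) u r s : two_sided_ideal M -> r.[0] = 0 ->
  M (nupoly u r) -> M (nupoly u (s * r)).
Proof.
move=> [sM iM] r0 Mr; have -> : s = (s - s.[0]%:P) + s.[0]%:P by rewrite subrK.
rewrite mulrDl nupolyD; apply: subspaceD => //; last first.
  by rewrite mul_polyC nupolyZ; apply: subspaceZ.
rewrite nupolyM // ?hornerD ?hornerN ?hornerC ?subrr //.
exact: (iM _ _ Mr).2.
Qed.

Variable x0 : X.

Lemma alg_hom_horner0 (v : X -> {poly k}) u : (forall x, (v x).[0] = 0) ->
  (free_eval v u).[0] = 0.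
Proof.
move=> v0; have vP := free_eval_hom v; move: u; apply: freealg0_ind.
- split; first by rewrite /= alg_hom0 // horner0.
  by move=> a f g /= f0 g0; rewrite vP.1 hornerD hornerZ f0 g0 mulr0 addr0.
- by move=> x; rewrite /= free_eval_letter.
- by move=> x f f0; rewrite /= alg_homM // hornerM f0 mulr0.
Qed.

(** The bridge to one variable: send each letter [y] to the polynomial [v y] in
    the single letter [x0]. The resulting endomorphism of the free algebra is
    the evaluation [free_eval v] into polynomials followed by substitution of
    [x0], because both are homomorphisms that agree on letters. *)
Lemma Tspace_onevar (M : set A) (v : X -> {poly k}) u : Tspace M ->
  (forall x, (v x).[0] = 0) -> M u -> M (nupoly (letter x0) (free_eval v u)).
Proof.
move=> MT v0 /(Tspace_endo MT (free_subst_endo (fun x => nupoly (letter x0) (v x)))).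
congr M; apply: val_inj; rewrite /= alg_hom_horner0 // subr0.
have e := alg_hom_ext (free_eval_hom (fun x => nupoly (letter x0) (v x) : kX))
  (alg_hom_horner (letter x0 : kX) (free_eval_hom v)).
by apply: e => x /=; rewrite !free_eval_letter /= v0 subr0.
Qed.

Lemma Tspace_comp (M : set A) r p : Tspace M -> p.[0] = 0 ->
  M (nupoly (letter x0) r) -> M (nupoly (letter x0) (r \Po p)).
Proof.
move=> MT p0 Mr; have := @Tspace_onevar M (fun=> p) _ MT (fun=> p0) Mr.
rewrite -[nupoly _ r]subr0 -(nupolyC (letter x0) r.[0]) -nupolyB.
rewrite alg_hom_nupoly; first last.
- by rewrite hornerD hornerN hornerC subrr.
- exact: free_eval_hom.
rewrite free_eval_letter horner_alg_poly comp_polyB comp_polyC nupolyB nupolyC.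
by rewrite subr0.
Qed.

Lemma Tspace_letter (M : set A) x : Tspace M -> M (letter x) -> M = setT.
Proof.
move=> MT Mx; apply/seteqP; split => // u _.
rewrite -(free_subst_letter (fun=> u) x).
exact: (Tspace_endo MT (free_subst_endo _)).
Qed.

End OneVariable.

(** * Spaces of polynomials closed under substitution *)
(** In the application [S r] says that [r(x0)] lies in a given T-space; to find
    the letter [x0] there is to derive [S 'X]. *)
Section Polynomials.
Variables (k : fieldType) (S : {poly k} -> Prop).
Hypothesis S_lin : forall a r s, S r -> S s -> S (a *: r + s).
Hypothesis S0 : S 0.
Hypothesis S_comp : forall r p, p.[0] = 0 -> S r -> S (r \Po p).

Lemma closed_scale a r : S r -> S (a *: r).
Proof. by move=> Sr; rewrite -[_ *: _]addr0; apply: S_lin. Qed.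

Lemma closed_sum (I : eqType) (cs : seq I) (P : pred I) (F : I -> {poly k}) :
  (forall i, P i -> S (F i)) -> S (\sum_(i <- cs | P i) F i).
Proof.
move=> SF; elim/big_ind: _ => // r s Sr Ss.
by rewrite -[r]scale1r; apply: S_lin.
Qed.

Lemma infinite_nonroot (p : {poly k}) :
  infinite_set [set: k] -> p != 0 -> exists c, p.[c] != 0.
Proof.
move=> infk p0; apply: contrapT => nc.
have [B _ sB] := infinite_set_fset (size p) infk.
suff : (size (finmap.enum_fset B) < size p)%N by rewrite ltnNge sB.
apply: max_poly_roots => //; last exact: finmap.fset_uniq.
apply/allP => c _; apply/rootP; apply: contrapT => pc.
by apply: nc; exists c; apply/eqP.
Qed.

(** Over an infinite field the homogeneous components can be separated: if [n]
    is the degree of [h] and [c^n <> c], then [h(cT) - c^n h(T)] has lower degree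
    and still has a nonzero linear coefficient. *)
Lemma linear_part_infinite h : infinite_set [set: k] ->
  S h -> h.[0] = 0 -> h`_1 != 0 -> S 'X.
Proof.
move=> infk; have [n] := ubnP (size h); elim: n h => // n IHn h hn Sh h0 h1.
have h00 : h`_0 = 0 by rewrite -horner_coef0.
have [h2|h2] := leqP (size h) 2.
  suff <- : (h`_1)^-1 *: h = 'X by apply: closed_scale.
  apply/polyP => -[|[|i]]; rewrite coefZ coefX /= ?h00 ?mulr0 ?mulVf //.
  by rewrite [h`_i.+2]nth_default ?mulr0 // (leq_trans h2).
have [|c] := @infinite_nonroot ('X^((size h).-1) - 'X) infk.
  apply/negP => /eqP/polyP/(_ 1%N)/eqP; rewrite coefB coefX coefXn coef0 /=.
  by case: (size h) h2 => [|[|[|m]]] //= _; rewrite sub0r oppr_eq0 oner_eq0.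
rewrite hornerD hornerN hornerXn hornerX => cn.
have hc i : (h \Po (c *: 'X))`_i = c ^+ i * h`_i.
  rewrite comp_polyE.
  rewrite (eq_bigr (fun i : 'I_(size h) => (c ^+ i * h`_i) *: 'X^i)); last first.
    by move=> j _; rewrite exprZn scalerA mulrC.
  rewrite -(poly_def _ (fun i => c ^+ i * h`_i)) coef_poly.
  by case: ltnP => // /(nth_default 0) ->; rewrite mulr0.
pose g := (- c ^+ (size h).-1) *: h + (h \Po (c *: 'X)).
have gc i : g`_i = (c ^+ i - c ^+ (size h).-1) * h`_i.
  by rewrite coefD coefZ hc mulrBl addrC mulNr.
apply: (IHn g).
- apply: leq_ltn_trans (_ : (size h).-1 < n)%N; last by case: (size h) hn h2.
  apply/leq_sizeP => j; rewrite leq_eqVlt => /orP[/eqP<-|hj].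
    by rewrite gc subrr mul0r.
  by rewrite gc nth_default ?mulr0 //; case: (size h) hj.
- by apply: S_lin => //; apply: S_comp => //; rewrite hornerZ hornerX mulr0.
- by rewrite horner_coef0 gc h00 mulr0.
- by rewrite gc expr1 mulf_neq0 // -oppr_eq0 opprB.
Qed.

(** Write [d = T e] with [e(0) <> 0]. The polynomial [p = 1 - e / e(0)] vanishes
    at [0] and is congruent to [1] modulo [e], so [h(p)] is congruent to [h(1)]
    modulo [e] and [T h(p)] to [h(1) T] modulo [d]. *)
Lemma linear_part_ideal d h :
  (forall r s, r.[0] = 0 -> S r -> S (s * r)) ->
  S d -> d.[0] = 0 -> d`_1 != 0 -> S h -> h.[0] = 0 -> h.[1] != 0 -> S 'X.
Proof.
move=> S_mul Sd d0 d1 Sh h0 h1.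
have [e dE] := poly_root0 d0.
have e0 : e.[0] != 0 by move: d1; rewrite dE coefMX /= horner_coef0.
pose p := 1 - e.[0]^-1 *: e.
have p0 : p.[0] = 0 by rewrite hornerD hornerN hornerZ mulVf // hornerC subrr.
have /factor_theorem[g hE] : root (h - h.[1]%:P) 1.
  by rewrite /root hornerD hornerN hornerC subrr.
suff XE : h.[1] *: 'X = e.[0]^-1 *: ((g \Po p) * d) + 'X * (h \Po p).
  rewrite -[X in S X](scalerK h1); apply: closed_scale; rewrite XE.
  apply: S_lin; first exact: S_mul.
  by apply: S_mul (S_comp _ _) => //; rewrite horner_comp p0.
have -> : h \Po p = h.[1]%:P + (g \Po p) * (p - 1).
  rewrite -[in LHS](subrK h.[1]%:P h) hE comp_polyD comp_polyM comp_polyC.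
  by rewrite comp_polyB comp_polyX !comp_polyC addrC.
have -> : p - 1 = - (e.[0]^-1 *: e) by rewrite /p addrC addKr.
by rewrite dE -!mul_polyC; ring.
Qed.

(** Over a field of order [q] the polynomial [delta c] is the indicator function
    of the point [c], and vanishes at [0] when [c <> 0]. Hence [h(delta c)] is,
    as a function, [h(1)] times this indicator, and the identity function is the
    sum over [c <> 0] of [c] times the indicator of [c]. *)
Lemma nonvanishing_part_finite (q : nat) (cs : seq k) h :
  (1 < q)%N -> (forall a : k, a ^+ q = a) -> uniq cs -> (forall a, a \in cs) ->
  (forall r, (forall a, r.[a] = 0) -> S r) ->
  S h -> h.[0] = 0 -> h.[1] != 0 -> S 'X.
Proof.
move=> q1 aq csu csT S_van Sh h0 h1.
pose delta c : {poly k} := 1 - ('X - c%:P) ^+ q.-1.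
have deltaE c a : (delta c).[a] = (a == c)%:R.
  rewrite hornerD hornerN hornerC horner_exp hornerXsubC -subr_eq0.
  case: eqVneq => [->|ac].
    by case: (q) q1 => [|[|m]] //= _; rewrite expr0n subr0.
  have /eqP := aq (a - c); rewrite -[X in _ ^+ X]prednK ?(ltnW q1) // exprS.
  by rewrite -[X in _ == X]mulr1 (inj_eq (mulfI ac)) => /eqP ->; rewrite subrr.
pose g := \sum_(c <- cs | c != 0) (c / h.[1]) *: (h \Po delta c).
suff Sg : S g.
  rewrite -['X](subrK g) -[_ - _]scale1r; apply: S_lin => //; apply: S_van => a.
  rewrite hornerD hornerN hornerX horner_sum.
  rewrite big_mkcond (bigD1_seq a) //= big1 => [|c ca]; last first.
    rewrite hornerZ horner_comp deltaE [a == c]eq_sym (negPf ca) mulr0n h0.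
    by rewrite mulr0 if_same.
  rewrite hornerZ horner_comp deltaE eqxx mulr1n mulfVK // addr0.
  by case: eqVneq => [->|]; rewrite subrr.
apply: closed_sum => c c0; apply/closed_scale/S_comp => //.
by rewrite deltaE eq_sym (negPf c0) mulr0n.
Qed.

End Polynomials.

(** * The two candidate maximal T-ideals *)
Section TwoTideals.
Variables (k : fieldType) (X : choiceType).
Local Notation A := (freealg0 k X).

(** The elements without linear part. The linear part is read off through
    homomorphisms to polynomials instead of coefficients of words, so that
    stability under endomorphisms is immediate. *)
Definition no_linear : set A := [set f | forall phi : A -> {poly k},
  alg_hom phi -> (forall u, (phi u).[0] = 0) -> (phi f)`_1 = 0].

(** The elements that vanish at every point of the affine space over [k] with
    coordinates [X], that is, the polynomial identities of [k]. *)
Definition vanishing : set A :=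
  [set f | forall phi : A -> k^o, alg_hom phi -> phi f = 0].

Lemma no_linear_mul (u v : A) : no_linear (u ** v).
Proof.
move=> phi phiP phi0; rewrite alg_homM // coefM big_ord_recl big_ord1 /=.
by rewrite -!horner_coef0 !phi0 mul0r mulr0 addr0.
Qed.

Lemma no_linear_Tideal : Tideal no_linear.
Proof.
have sub : subspace no_linear.
  split=> [phi phiP _|a u v Lu Lv phi phiP phi0].
    by rewrite alg_hom0 // coef0.
  by rewrite phiP.1 coefD coefZ Lu // Lv // mulr0 addr0.
split; split=> //; last by move=> u v _; split; exact: no_linear_mul.
move=> f fP _ [u Lu <-] phi phiP phi0.
by apply: (Lu (phi \o f)) => [|v]; [exact: alg_hom_endo | exact: phi0].
Qed.

Lemma vanishing_Tideal : Tideal vanishing.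
Proof.
have sub : subspace vanishing.
  split=> [phi phiP|a u v Lu Lv phi phiP]; first by rewrite alg_hom0.
  by rewrite phiP.1 Lu // Lv // scaler0 addr0.
split; split=> //.
  move=> f fP _ [u Lu <-] phi phiP.
  by apply: (Lu (phi \o f)); exact: alg_hom_endo.
by move=> u v Lu; split=> phi phiP; rewrite alg_homM // Lu // ?mul0r ?mulr0.
Qed.

Lemma vanishing_pow q (u : A) : (0 < q)%N -> (forall a : k, a ^+ q = a) ->
  vanishing (u - nuexp u q).
Proof.
move=> q0 aq phi phiP; rewrite alg_homB // alg_hom_nuexp // [_ ^+ q]aq.
exact: subrr.
Qed.

Lemma vanishing_comm (u v : A) : vanishing (nucomm u v).
Proof.
by move=> phi phiP; rewrite alg_homB // !alg_homM // mulrC subrr.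
Qed.

Variable x0 : X.
Local Notation x := (letter x0 : A).

Lemma letter_not_no_linear : ~ no_linear x.
Proof.
move=> /(_ _ (free_eval_hom (fun=> 'X))); rewrite free_eval_letter coefX => h.
have /eqP : ((1%N == 1%N)%:R : k) = 0.
  by apply: h => u; apply: alg_hom_horner0 => _; rewrite hornerX.
by rewrite oner_eq0.
Qed.

Lemma not_vanishing (phi : A -> k^o) f :
  alg_hom phi -> phi f != 0 -> ~ vanishing f.
Proof. by move=> phiP f0 /(_ _ phiP) /eqP; exact/negP. Qed.

Lemma letter_not_vanishing : ~ vanishing x.
Proof.
apply: (not_vanishing (free_eval_hom (fun=> 1))).
by rewrite free_eval_letter oner_eq0.
Qed.

Lemma no_linear_nupoly (r : {poly k}) : r`_1 = 0 -> no_linear (nupoly x r).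
Proof.
move=> r1 phi phiP phi0.
rewrite -[nupoly x r]subr0 -(nupolyC x r.[0]) -nupolyB.
have : (r - r.[0]%:P).[0] = 0 by rewrite hornerD hornerN hornerC subrr.
have : (r - r.[0]%:P)`_1 = 0 by rewrite coefB coefC subr0.
move: (r - _) => {r1}r r1 r0; rewrite alg_hom_nupoly // horner_alg_poly.
have [s rE] := poly_root0 r0; have [|t sE] := @poly_root0 _ s.
  by move: r1; rewrite rE coefMX /= horner_coef0.
have [w wE] := poly_root0 (phi0 x).
rewrite rE sE !comp_polyM comp_polyX wE.
by rewrite mulrA coefMX /= mulrAC mulrA coefMX.
Qed.

(** A homomorphism that detects a linear part is an evaluation at polynomials
    without constant term, so it can be performed inside the T-space. *)
Lemma Tspace_linear_part (M : set A) f : Tspace M -> M f -> ~ no_linear f ->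
  exists h : {poly k}, [/\ M (nupoly x h), h.[0] = 0 & h`_1 != 0].
Proof.
move=> MT Mf /existsNP[phi] /not_implyP[phiP] /not_implyP[phi0] /eqP f1.
exists (phi f); split=> //; rewrite (free_eval_unique phiP).
by apply: Tspace_onevar => // y; exact: phi0.
Qed.

(** If [f] does not vanish at the point [a], substitute [a_y T] for each letter
    [y]: the value of the result at [1] is [f(a)]. *)
Lemma Tspace_nonvanishing_part (M : set A) f : Tspace M -> M f ->
  ~ vanishing f ->
  exists h : {poly k}, [/\ M (nupoly x h), h.[0] = 0 & h.[1] != 0].
Proof.
move=> MT Mf /existsNP[phi] /not_implyP[phiP] /eqP f0.
pose v y : {poly k} := (phi (letter y) : k) *: 'X.
have v0 y : (v y).[0] = 0 by rewrite hornerZ hornerX mulr0.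
exists (free_eval v f); split; first exact: Tspace_onevar.
  exact: alg_hom_horner0.
have e := alg_hom_ext (alg_hom_horner (1 : k^o) (free_eval_hom v)) phiP.
suff -> : (free_eval v f).[1] = phi f by [].
rewrite -(horner_alg_regular 1); apply: e => y.
by rewrite /= free_eval_letter horner_alg_regular hornerZ hornerX mulr1.
Qed.

(** A T-space is proper exactly when it omits the letter [x0], since any
    element is the image of that letter under an endomorphism. *)
Lemma maximal_TspaceI (V : set A) : Tspace V -> ~ V x ->
  (forall N f, Tspace N -> V `<=` N -> N f -> ~ V f -> N x) ->
  maximal_Tspace V.
Proof.
move=> VT Vx Vmax; split.
  by split=> // VE; apply: Vx; rewrite VE.
move=> N [NT NT'] VN; apply/seteqP; split=> // f Nf; apply: contrapT => Vf.
by apply: NT'; apply: (@Tspace_letter _ _ _ x0) => //; exact: Vmax Vf.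
Qed.

Lemma maximal_Tideal_of_Tspace (V : set A) :
  Tideal V -> maximal_Tspace V -> maximal_Tideal V.
Proof.
move=> VI [[VT VnT] Vmax]; split; first by split.
by move=> N [[NT _] Nn]; apply: Vmax.
Qed.

Lemma Tspace_poly_lin (M : set A) : Tspace M ->
  forall a r s, M (nupoly x r) -> M (nupoly x s) -> M (nupoly x (a *: r + s)).
Proof. by move=> [[_ h] _] a r s Mr Ms; rewrite nupoly_linear; apply: h. Qed.

Lemma Tspace_poly0 (M : set A) : Tspace M -> M (nupoly x 0).
Proof. by move=> [[h _] _]; rewrite -polyC0 nupolyC. Qed.

Lemma no_linear_maximal : maximal_Tspace no_linear.
Proof.
apply: maximal_TspaceI (letter_not_no_linear) _; first exact: no_linear_Tideal.1.
move=> N f NT LN Nf /(Tspace_linear_part NT Nf)[h [Nh h0 h1]].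
have -> : x = (h`_1)^-1 *: (nupoly x h - nupoly x (h - h`_1 *: 'X)).
  by rewrite -nupolyB subKr nupolyZ nupolyX scalerA mulVf // scale1r.
apply/(subspaceZ _ NT.1)/(subspaceB NT.1) => //; apply: LN.
by apply: no_linear_nupoly; rewrite coefB coefZ coefX mulr1 subrr.
Qed.

Lemma Tspace_infinite (N : set A) f : infinite_set [set: k] -> Tspace N ->
  N f -> ~ no_linear f -> N x.
Proof.
move=> infk NT Nf /(Tspace_linear_part NT Nf)[h [Nh h0 h1]].
rewrite -(nupolyX x).
apply: (linear_part_infinite (Tspace_poly_lin NT) (Tspace_poly0 NT) _ _ Nh) =>
  //.
by move=> r p p0; exact: Tspace_comp.
Qed.

(** In other words, a proper T-ideal lies in [no_linear] or in [vanishing]. *)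
Lemma Tideal_dichotomy (M : set A) f g : Tideal M ->
  M f -> ~ no_linear f -> M g -> ~ vanishing g -> M x.
Proof.
move=> [MT Mi] Mf /(Tspace_linear_part MT Mf)[d [Md d0 d1]].
move=> Mg /(Tspace_nonvanishing_part MT Mg)[h [Mh h0 h1]].
rewrite -(nupolyX x).
apply: (linear_part_ideal (Tspace_poly_lin MT) (Tspace_poly0 MT) _ _ Md
  _ _ Mh) => //.
- by move=> r p p0; exact: Tspace_comp.
- by move=> r s r0; exact: ideal_nupoly.
Qed.

Lemma vanishing_maximal q (cs : seq k) :
  (1 < q)%N -> (forall a : k, a ^+ q = a) -> uniq cs -> (forall a, a \in cs) ->
  maximal_Tspace vanishing.
Proof.
move=> q1 aq csu csT.
apply: maximal_TspaceI (letter_not_vanishing) _; first exact: vanishing_Tideal.1.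
move=> N f NT LN Nf /(Tspace_nonvanishing_part NT Nf)[h [Nh h0 h1]].
rewrite -(nupolyX x).
apply: (nonvanishing_part_finite (Tspace_poly_lin NT) (Tspace_poly0 NT) _
  q1 aq csu csT _ Nh) => //.
- by move=> r p p0; exact: Tspace_comp.
- move=> r r0; apply: LN => phi phiP.
  by rewrite alg_hom_nupoly // horner_alg_regular r0.
Qed.

End TwoTideals.

(** * The T-ideal generated by a product of letters *)
Section IdentifyZ.
Variables (k : fieldType) (X : choiceType).
Local Notation kX := (freealg1 k X).
Local Notation A := (freealg0 k X).

(** The coefficient at the letter [y] is the linear coefficient of the
    evaluation that sends [y] to the variable and the other letters to [0]. *)
Lemma no_linear_coef (f : A) y : no_linear f -> (f : kX)@_(fmu y) = 0.
Proof.
pose v z : {poly k} := if z == y then 'X else 0.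
have v0 z : (v z).[0] = 0 by rewrite /v; case: eqP; rewrite ?hornerX ?horner0.
have vP := free_eval_hom v; have vf0 u := alg_hom_horner0 u v0.
move=> /(_ _ vP vf0) <-; apply/esym; move: f; apply: freealg0_ind.
- split; first by rewrite /= alg_hom0 // coef0 mcoeff0.
  move=> a g h /= eg eh; rewrite vP.1 coefD coefZ eg eh.
  exact/esym/(etrans (mcoeffD _ _ _))/(congr1 (+%R^~ _))/mcoeffZ.
- move=> z; rewrite /= free_eval_letter mcoeffU1 /v fmP !fmU eqseq_cons andbT.
  by case: eqP; rewrite ?coefX ?coef0.
- move=> z g _; rewrite /= (no_linear_mul _ _ vP vf0).
  exact/esym/(mcoeff_fmu_mul (letter z) g).
Qed.

(** In the expansion of an element of [no_linear] only words of length at least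
    two remain, and these are products. *)
Lemma no_linear_sub (Z : set A) :
  subspace Z -> (forall u v, Z (u ** v)) -> no_linear (X := X) `<=` Z.
Proof.
move=> sZ Zmul f Lf; rewrite (freealg0_expand f).
apply: subspace_sum => // -[[|y [|z s]]] /= _.
- by rewrite scaler0; exact: subspace0.
- by rewrite -fmuE no_linear_coef // scale0r; exact: subspace0.
- by apply: subspaceZ => //; exact: Zmul.
Qed.

Lemma single_letter_ind (x : X) (S : set A) : [set: X] = [set x] ->
  subspace S -> S (letter x) -> (forall u, S u -> S (letter x ** u)) ->
  forall u, S u.
Proof.
move=> X1 sS Sx Sm; have Xx (y : X) : y = x.
  by move: (I : [set: X] y); rewrite X1.
by apply: freealg0_ind => // [y|y u]; rewrite (Xx y) //; apply: Sm.
Qed.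

Lemma is_Z_no_linear (Z : set A) : is_Z Z -> Z = no_linear (X := X).
Proof.
case=> [[x [y [xy ->]]]|[x [X1 ->]]]; apply/seteqP; split.
- apply: smallest_sub; first exact: no_linear_Tideal.
  by move=> _ ->; exact: no_linear_mul.
- move=> f Lf M [MI Mxy]; apply: no_linear_sub Lf; first exact: MI.1.1.
  move=> u v.
  have fP := free_subst_endo (fun z => if z == x then u else v).
  have := Tspace_endo MI.1 fP.
  move=> /(_ (letter x ** letter y)); rewrite fP.2 !free_subst_letter.
  by rewrite eqxx; case: eqP => [/esym//|_]; apply; exact: Mxy.
- apply: smallest_sub; first exact: no_linear_Tideal.
  by move=> _ ->; exact: no_linear_mul.
- move=> f Lf M [MI Mxx]; apply: no_linear_sub Lf; first exact: MI.1.1.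
  have [[sM _] [_ iM]] := MI.
  have Mxv v : M (letter x ** v).
    apply: (single_letter_ind (S := [set v | M (letter x ** v)]) X1) => /=.
    + split=> [|a u w /= Mu Mw]; first by rewrite /= numul0; exact: subspace0.
      by rewrite numulDr -nuscaleAr; apply: sM.2.
    + exact: Mxx.
    + by move=> u _; rewrite numulA; apply: (iM _ _ (Mxx _ erefl)).1.
  move=> u v.
  apply: (single_letter_ind (S := [set u | M (u ** v)]) X1) => //=.
  + split=> [|a w w' /= Mu Mw]; first by rewrite /= nu0mul; exact: subspace0.
    by rewrite numulDl -nuscaleAl; apply: sM.2.
  + by move=> w _; rewrite -numulA.
Qed.

Lemma single_letter_comm (x : X) (u v : A) :
  [set: X] = [set x] -> nucomm u v = 0.
Proof.
move=> X1; apply/eqP; rewrite subr_eq0; apply/eqP.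
have sub w : subspace [set w' : A | w ** w' = w' ** w].
  split=> [|a s t /= es et]; first by rewrite /= numul0 nu0mul.
  by rewrite numulDl numulDr -nuscaleAl -nuscaleAr es et.
have xv (w : A) : letter x ** w = w ** letter x.
  have h := single_letter_ind X1 (sub (letter x)).
  apply: (h _ _ w) => [|s es]; first by [].
  by rewrite /= -numulA -es.
have h := single_letter_ind X1 (sub u); apply: (h _ _ v) => /= [|s es].
  by rewrite xv.
by rewrite -numulA -es !numulA xv.
Qed.

End IdentifyZ.

(** * Zorn's lemma for T-spaces and ideals *)
Section Zorn.
Variables (T : Type) (Q : set (set T)).

(** Zorn's lemma with the chain condition restricted to nonempty chains: the
    union of the empty chain is the empty set, which is never a subspace. The
    proof adds the empty set to the family. *)
Lemma zorn_maximal (V : set T) : Q V ->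
  (forall F : set (set T), F !=set0 -> F `<=` Q -> total_on F subset ->
     Q (\bigcup_(B in F) B)) ->
  exists M, Q M /\ forall N, Q N -> M `<=` N -> N = M.
Proof.
move=> QV Qchain.
have [F FP Ftot|M [MP Mmax]] := @Zorn_bigcup _ [set B | B = set0 \/ Q B].
  have [[B [FB QB]]|F0] := pselect (exists B, F B /\ Q B).
    right; have -> : \bigcup_(B in F) B = \bigcup_(B in F `&` Q) B.
      apply/seteqP; split=> t [C]; last by move=> [FC _] Ct; exists C.
      move=> FC Ct; exists C => //; split=> //.
      by have [C0|//] := FP _ FC; move: Ct; rewrite C0.
    apply: Qchain; first by exists B.
      by move=> C [].
    by move=> C D [FC _] [FD _]; exact: Ftot.
  left; rewrite -subset0 => t [C FC Ct].
  by have [C0|QC] := FP _ FC; [move: Ct; rewrite C0 | case: F0; exists C].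
have QM : Q M.
  case: MP => // M0; have [V0|/eqP V0] := pselect (V = set0).
    by rewrite M0 -V0.
  suff /Mmax : M `<` V by case; right.
  rewrite M0; split; first exact: sub0set.
  by rewrite subset0 => /eqP; exact/negP.
exists M; split=> // N QN MN; apply: contrapT => NM.
apply: (Mmax N); last by right.
by split=> // MN'; apply: NM; apply/seteqP.
Qed.

End Zorn.

Section Chains.
Variables (k : fieldType) (A : nuAlgType k) (F : set (set A)).
Hypotheses (F0 : F !=set0) (Ftot : total_on F subset).

Lemma subspace_bigcup :
  (forall B, F B -> subspace B) -> subspace (\bigcup_(B in F) B).
Proof.
move=> FS; split.
  by have [B FB] := F0; exists B => //; exact: subspace0 (FS _ FB).
move=> a u v [B FB Bu] [C FC Cv].
have [BC|CB] := Ftot FB FC.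
  by exists C => //; apply: (FS _ FC).2 => //; exact: BC.
by exists B => //; apply: (FS _ FB).2 => //; exact: CB.
Qed.

Lemma two_sided_ideal_bigcup :
  (forall B, F B -> two_sided_ideal B) -> two_sided_ideal (\bigcup_(B in F) B).
Proof.
move=> FI; split; first by apply: subspace_bigcup => B /FI[].
by move=> u v [B FB Bu]; split; exists B => //; have [] := (FI _ FB).2 u v Bu.
Qed.

Lemma Tspace_bigcup :
  (forall B, F B -> Tspace B) -> Tspace (\bigcup_(B in F) B).
Proof.
move=> FT; split; first by apply: subspace_bigcup => B /FT[].
move=> f fP _ [u [B FB Bu] <-]; exists B => //.
exact: Tspace_endo (FT _ FB) fP Bu.
Qed.

End Chains.

Lemma nuexpS (k : fieldType) (A : nuAlgType k) (u : A) n :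
  nuexp u n.+2 = u ** nuexp u n.+1.
Proof. by rewrite /nuexp !iteropS iterS. Qed.

(** * Separating elements by points over a finite field *)
Section Shifted.
Variables (k : fieldType) (A : nuAlgType k).
Implicit Types (u v r s : A) (a c : k).

(** The action of [u - c], which is not itself an element of a nonunitary
    algebra. *)
Definition shifted u c r : A := u ** r - c *: r.

Lemma shiftedP u c a r s :
  shifted u c (a *: r + s) = a *: shifted u c r + shifted u c s.
Proof.
rewrite /shifted numulDr -nuscaleAr scalerDr scalerA mulrC -scalerA opprD addrACA.
by rewrite -scalerBr.
Qed.

Lemma shiftedB u c r s : shifted u c (r - s) = shifted u c r - shifted u c s.
Proof. by rewrite addrC -[- s]scaleN1r shiftedP scaleN1r addrC. Qed.

Lemma shifted_mull u c r s : shifted u c (r ** s) = shifted u c r ** s.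
Proof. by rewrite /shifted numulBl numulA nuscaleAl. Qed.

Lemma shifted_swap u c r s :
  r ** shifted u c s - shifted u c (r ** s) = nucomm r u ** s.
Proof.
by rewrite /shifted numulBr -nuscaleAr opprB addrA subrK !numulA -numulBl.
Qed.

Lemma shifted_diff u c c' r : shifted u c r - shifted u c' r = (c' - c) *: r.
Proof. by rewrite /shifted opprB addrC subrKA -scalerBl. Qed.

Lemma shifted_lin a u v c c' r :
  shifted (a *: u + v) (a * c + c') r = a *: shifted u c r + shifted v c' r.
Proof.
by rewrite /shifted numulDl -nuscaleAl scalerBr scalerDl scalerA opprD addrACA.
Qed.

Lemma shifted_mul u v c c' r :
  shifted (u ** v) (c * c') r = u ** shifted v c' r + c' *: shifted u c r.
Proof.
by rewrite /shifted numulBr -nuscaleAr scalerBr addrA subrK numulA scalerA mulrC.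
Qed.

End Shifted.

Section PointSeparation.
Variables (k : fieldType) (X : choiceType).
Local Notation kX := (freealg1 k X).
Local Notation A := (freealg0 k X).

Lemma val_shifted_prod (u : A) (cs : seq k) (R : A) :
  (foldr (shifted u) R cs : kX) =
  horner_alg (u : kX) (\prod_(c <- cs) ('X - c%:P)) * R.
Proof.
elim: cs => [|c cs IHcs] /=; first by rewrite big_nil rmorph1 mul1r.
rewrite IHcs big_cons rmorphM -mulrA rmorphB /= horner_algX horner_algC.
by rewrite mulrBl mulr_algl.
Qed.

Variables (q : nat) (cs : seq k) (W : set A).
Hypothesis q1 : (1 < q)%N.
Hypothesis csE : 'X^q - 'X = \prod_(c <- cs) ('X - c%:P).
Hypothesis WI : two_sided_ideal W.
Hypothesis Wcomm : forall u v, W (nucomm u v).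
Hypothesis Wpow : forall u, W (u - nuexp u q).

(** Take an ideal [J] containing [W], maximal among those that miss [f]. For
    each [u] some [u - c] with [c] in [k] sends the whole algebra into [J]:
    otherwise [f] lies in [J + (u - c)A] for all [c], and multiplying these
    memberships over all [c] puts a power of [f] in
    [J + (\prod_c (u - c)) A = J + (u^q - u) A = J], hence [f] itself. The map
    sending [u] to this [c] is a homomorphism to [k], and it does not kill [f],
    as otherwise [f^2], and with it [f^q], would lie in [J]. *)
Lemma point_separation f : ~ W f -> ~ vanishing f.
Proof.
move=> Wf.
pose Q := [set J : set A | [/\ two_sided_ideal J, W `<=` J & ~ J f]].
have [||J [[JI WJ Jf] Jmax]] := @zorn_maximal _ Q W.
- by split.
- move=> F F0 FQ Ftot; split.
  + by apply: two_sided_ideal_bigcup => // B /FQ[].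
  + have [B FB] := F0; have [_ WB _] := FQ _ FB.
    by move=> u Wu; exists B => //; exact: WB.
  + by move=> [B FB Bf]; have [] := FQ _ FB.
have [sJ iJ] := JI; have J0 := subspace0 sJ.
have Jl u v : J u -> J (v ** u) by move=> /(iJ u v)[].
have Jr u v : J u -> J (u ** v) by move=> /(iJ u v)[].
have Jcong u v : J (u - v) -> J v -> J u.
  by move=> uv Jv; rewrite -[u](subrK v); apply: subspaceD.
have Jtrans v u w : J (u - v) -> J (v - w) -> J (u - w).
  by move=> uv vw; rewrite -[u](subrK v) -addrA; apply: subspaceD.
(* [f] is congruent to [f^q], a multiple of [f^2] because [1 < q]. *)
have Jff : J (f ** f) -> False.
  move=> ff; apply: Jf; apply: (Jcong _ (nuexp f q)); first exact/WJ/Wpow.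
  case: (q) q1 => [|[|n]] // _; elim: n => [|n IHn] //.
  by rewrite nuexpS; apply: Jl.
have Jshift u c r : J r -> J (shifted u c r).
  by move=> Jr'; apply: subspaceB => //; [apply: Jl|apply: subspaceZ].
have Jswap u c r s : J (r ** shifted u c s - shifted u c (r ** s)).
  by rewrite shifted_swap; exact/Jr/WJ/Wcomm.
have Jpoint u : exists c, forall r, J (shifted u c r).
  apply: contrapT => /forallNP nc.
  have fc c : exists r, J (f - shifted u c r).
    apply: contrapT => nf; apply: (nc c) => r.
    pose Jc := [set v : A | exists r, J (v - shifted u c r)].
    (* [Jc] is the ideal [J + (u - c)A]; being larger than [J], it would
       contain [f] unless it equals [J]. *)
    have <- : Jc = J.
      apply: Jmax; last first.
        move=> v Jv; exists 0; apply: subspaceB => //.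
        exact: Jshift.
      split=> //; last first.
        move=> v Wv; exists 0; apply: subspaceB; [done|exact: WJ|].
        exact: Jshift.
      split; first split.
      - exists 0; apply: subspaceB => //.
        exact: Jshift.
      - move=> a v w [r1 J1] [r2 J2]; exists (a *: r1 + r2).
        by rewrite shiftedP opprD addrACA -scalerBr; apply: sJ.2.
      - move=> v w [r1 J1]; split; [exists (r1 ** w)|exists (w ** r1)].
          rewrite shifted_mull -numulBl; exact: Jr.
        apply: (Jtrans (w ** shifted u c r1)) => //.
        by rewrite -numulBr; exact: Jl.
    by exists r; rewrite subrr; exact: subspace0.
  (* Modulo [J] the product of the operators [u - d] commutes with left
     multiplication, since commutators lie in [J]. *)
  have prodJ ds r s : J (r ** foldr (shifted u) s ds -
                          foldr (shifted u) (r ** s) ds).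
    elim: ds => [|d ds IHds] /=; first by rewrite subrr; exact: subspace0.
    set y := foldr _ s ds; set z := foldr _ _ ds.
    apply: (Jtrans (shifted u d (r ** y))) => //.
    by rewrite -shiftedB; exact: Jshift.
  have pow_prod ds : exists R, J (nuexp f (size ds).+1 - foldr (shifted u) R ds).
    elim: ds => [|d ds [R JR]]; first by exists f; rewrite subrr.
    have [r Jfr] := fc d; exists (r ** R).
    rewrite [foldr _ _ _]/= -[size (d :: ds)]/(size ds).+1 nuexpS.
    set y := nuexp _ _ in JR *; set z := foldr _ R ds in JR.
    apply: (Jtrans (f ** z)); first by rewrite -numulBr; exact: Jl.
    apply: (Jtrans (shifted u d (r ** z))).
      by rewrite shifted_mull -numulBl; exact: Jr.
    by rewrite -shiftedB; exact/Jshift/prodJ.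
  have [R JR] := pow_prod cs.
  have RE : foldr (shifted u) R cs = (nuexp u q - u) ** R.
    apply: val_inj => /=.
    rewrite val_shifted_prod -csE rmorphB rmorphXn /= horner_algX.
    congr (_ * _); congr (_ - _).
    by rewrite (alg_hom_nuexp (@val_alg_hom k X)) // ltnW.
  have scs : size cs = q.
    have := congr1 (size \o val) csE => /=.
    rewrite size_prod_XsubC size_polyDl ?size_polyXn; first by case.
    by rewrite size_polyN size_polyX ltnS.
  have J4 : J ((nuexp u q - u) ** R).
    by apply: Jr; rewrite -opprB -scaleN1r; apply: subspaceZ => //; exact/WJ/Wpow.
  apply: Jff; have := Jcong _ _ JR; rewrite RE => /(_ J4); rewrite scs.
  case: (q) q1 Wpow => [|n] // _ Wp; rewrite nuexpS => J5.
  by apply: Jcong J5; rewrite -numulBr; exact/Jl/WJ/Wp.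
have [phi phiP] := choice Jpoint.
have phi_unique u c : (forall r, J (shifted u c r)) -> phi u = c.
  move=> uc; apply: contrapT => /eqP; rewrite -subr_eq0 => pc; apply: Jf.
  rewrite -[f](scalerK pc); apply: subspaceZ => //.
  by rewrite -(shifted_diff u); apply: subspaceB.
have phi_hom : @alg_hom _ _ (k^o) phi.
  split=> [a u v|u v]; apply: phi_unique => r.
    by have := sJ.2 a _ _ (phiP u r) (phiP v r); rewrite -shifted_lin.
  have := subspaceD sJ (Jl _ u (phiP v r)) (subspaceZ (phi v) sJ (phiP u r)).
  by rewrite -shifted_mul.
apply: (not_vanishing phi_hom); apply/eqP => f0; apply: Jff.
by have := phiP f f; rewrite /shifted f0 scale0r subr0.
Qed.

End PointSeparation.

(** * The T-ideal generated by commutators and x - x^q *)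
Section IdentifyW.
Variables (k : fieldType) (X : choiceType).
Local Notation A := (freealg0 k X).

Lemma Tideal_gen_Tideal (H : set A) : Tideal (Tideal_gen H).
Proof.
have sG : subspace (Tideal_gen H).
  split=> [M [[[sM _] _] _]|a u v Gu Gv M [MI HM]]; first exact: subspace0.
  by apply: MI.1.1.2; [exact: Gu|exact: Gv].
split; split=> //.
  move=> f fP _ [u Gu <-] M [MI HM]; apply: (Tspace_endo MI.1 fP); exact: Gu.
by move=> u v Gu; split=> M [MI HM]; have [] := MI.2.2 u v (Gu _ (conj MI HM)).
Qed.

Lemma Tideal0 : Tideal ([set 0] : set A).
Proof.
have s0 : subspace ([set 0] : set A).
  by split=> // a u v -> ->; rewrite /= scaler0 addr0.
split; split=> //.
  move=> f fP _ [u -> <-] /=; have := fP.1 (-1) 0 0.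
  by rewrite scaler0 add0r scaleN1r addNr.
by move=> u v ->; rewrite /= numul0 nu0mul.
Qed.

Lemma Tideal_add (S1 S2 : set A) :
  Tideal S1 -> Tideal S2 -> Tideal (set_add S1 S2).
Proof.
move=> [T1 [s1 i1]] [T2 [s2 i2]].
have s12 : subspace (set_add S1 S2).
  split.
    exists 0; first exact: subspace0.
    by exists 0; [exact: subspace0|rewrite addr0].
  move=> a _ _ [u Su [v Sv <-]] [u' Su' [v' Sv' <-]].
  exists (a *: u + u'); first exact: s1.2.
  exists (a *: v + v'); first exact: s2.2.
  by rewrite scalerDr addrACA.
split; split=> //.
  move=> f fP _ [_ [u Su [v Sv <-]] <-].
  exists (f u); first exact: (Tspace_endo T1).
  exists (f v); first exact: (Tspace_endo T2).
  by rewrite -[u in RHS]scale1r fP.1 scale1r.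
move=> _ w [u Su [v Sv <-]]; split.
  exists (u ** w); first exact: (i1 u w Su).1.
  by exists (v ** w); [exact: (i2 v w Sv).1|rewrite numulDl].
exists (w ** u); first exact: (i1 u w Su).2.
by exists (w ** v); [exact: (i2 v w Sv).2|rewrite numulDr].
Qed.

Lemma is_T2_Tideal (T2 : set A) : is_T2 T2 -> Tideal T2.
Proof.
by case=> [[x [_ ->]]|[x [y [_ ->]]]]; [exact: Tideal0|exact: Tideal_gen_Tideal].
Qed.

Lemma is_T2_vanishing (T2 : set A) : is_T2 T2 -> T2 `<=` vanishing (X := X).
Proof.
case=> [[x [_ ->]]|[x [y [_ ->]]]].
  by move=> _ -> phi phiP; rewrite alg_hom0.
apply: smallest_sub; first exact: vanishing_Tideal.
by move=> _ ->; exact: vanishing_comm.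
Qed.

Lemma is_T2_comm (T2 : set A) (u v : A) : is_T2 T2 -> T2 (nucomm u v).
Proof.
case=> [[x [X1 ->]]|[x [y [xy ->]]]]; first exact: single_letter_comm X1.
move=> M [MI HM].
have fP := free_subst_endo (fun z => if z == x then u else v).
have := Tspace_endo MI.1 fP (HM _ erefl).
rewrite /nucomm -scaleN1r addrC fP.1 !fP.2 !free_subst_letter eqxx scaleN1r addrC.
by case: eqP => [/esym|].
Qed.

(** One inclusion holds because commutators and [x - x^q] vanish on [k]; the
    other one is the separation of elements by points. *)
Lemma W0_vanishing (q : nat) (cs : seq k) (x : X) (T2 : set A) :
  (1 < q)%N -> (forall a : k, a ^+ q = a) ->
  'X^q - 'X = \prod_(c <- cs) ('X - c%:P) -> is_T2 T2 ->
  set_add T2 (Tideal_gen [set letter x - nuexp (letter x) q]) =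
  vanishing (X := X).
Proof.
move=> q1 aq csE T2P; set G := Tideal_gen _.
have GI : Tideal G := Tideal_gen_Tideal _.
have WI := Tideal_add (is_T2_Tideal T2P) GI.
apply/seteqP; split.
  move=> _ [u T2u [v Gv <-]].
  apply: (subspaceD (vanishing_Tideal k X).1.1).
    exact: is_T2_vanishing T2u.
  apply: (smallest_sub (vanishing_Tideal k X)) Gv => _ ->.
  by apply: vanishing_pow => //; rewrite ltnW.
move=> f Vf; apply: contrapT => Wf.
apply: (point_separation q1 csE WI.2 _ _ Wf Vf).
  move=> u v; exists (nucomm u v); first exact: is_T2_comm.
  by exists 0; [exact: subspace0 GI.1.1|rewrite addr0].
move=> u; exists 0; first exact: subspace0 (is_T2_Tideal T2P).1.1.
exists (u - nuexp u q); last by rewrite add0r.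
have fP := free_subst_endo (fun=> u : A).
have Gx : G (letter x - nuexp (letter x) q) by move=> M [_]; apply.
have := Tspace_endo GI.1 fP Gx.
rewrite -scaleN1r addrC fP.1 free_subst_letter scaleN1r addrC.
suff -> : free_subst (fun=> u) (nuexp (letter x) q) = nuexp u q by [].
case: (q) q1 => [|n] // _; elim: n => [|n IHn]; first exact: free_subst_letter.
by rewrite nuexpS fP.2 IHn free_subst_letter -nuexpS.
Qed.

End IdentifyW.

(** * Finite fields *)
(** The canonical structures on finite fields are reached by equipping [k] with
    the enumeration that finiteness provides. *)
Lemma finite_field_data (k : fieldType) : finite_set [set: k] ->
  exists (p r : nat) (cs : seq k),
    [/\ p \in [pchar k], (1 < p ^ r)%N, (forall a : k, a ^+ (p ^ r) = a),
        [/\ uniq cs, forall a, a \in cs & [set: k] #= `I_(p ^ r)] &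
        'X^(p ^ r) - 'X = \prod_(c <- cs) ('X - c%:P)].
Proof.
move=> /finite_seqP[s sE].
have sP : Finite.axiom (undup s).
  move=> a; rewrite count_uniq_mem ?undup_uniq // mem_undup.
  by have : [set: k] a by []; rewrite sE /= => ->.
pose pickle (a : k) := index a s.
pose unpickle n := nth None (map Some s) n.
have pickleK : pcancel pickle unpickle.
  move=> a; have as_ : a \in s by have : [set: k] a by []; rewrite sE.
  by rewrite /unpickle (nth_map a) ?index_mem ?nth_index.
pose kC := Choice_isCountable.Build k pickleK.
pose kF := isFinite.Build k sP.
pose F : finFieldType := HB.pack k kC kF.
have [p p_pr pF] := finPcharP F.
have FE := card_pprimeChar pF; set r := logn p _ in FE.
exists p, r, (enum F); rewrite -FE; split=> //.
- exact: finNzRing_gt1.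
- exact: (@expf_card F).
- split; [exact: enum_uniq|by move=> a; exact: (mem_enum F a)|].
  apply/card_set_bijP; exists (fun a : F => nat_of_ord (enum_rank a)); split.
  + by move=> a _; exact: ltn_ord.
  + by move=> a b _ _ /val_inj; exact: enum_rank_inj.
  + by move=> i /= iF; exists (enum_val (Ordinal iF)); rewrite ?enum_valK.
- by rewrite (@finField_genPoly F) (@big_enum _ _ _ _ F).
Qed.

(** * Infinitely many maximal T-spaces over a finite field *)
Section FrobeniusTrace.
Variables (k : fieldType) (p r : nat).
Hypotheses (pk : p \in [pchar k]) (fix_k : forall a : k, a ^+ (p ^ r) = a).
Variable R : comAlgType k.
Implicit Types (u v b w : R) (a : k).
Local Notation q := (p ^ r)%N.

(** On the field with [q^n] elements, with [q = p^r], this is the trace down to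
    the field with [q] elements. *)
Definition frobenius_trace n u : R := \sum_(i < n) u ^+ (q ^ i).

Lemma frobenius_q_gt0 : (0 < q)%N.
Proof.
by rewrite lt0n; apply/eqP => q0; have /eqP := fix_k 0; rewrite q0 oner_eq0.
Qed.

Lemma fix_k_iter a i : a ^+ (q ^ i) = a.
Proof. by elim: i => [|i IHi]; rewrite ?expr1 // expnS exprM fix_k. Qed.

Lemma pchar_nat_exp i : [pchar R].-nat (q ^ i)%N.
Proof.
have pR : p \in [pchar R] by rewrite pchar_lalg.
by rewrite -expnM (eq_pnat _ (pcharf_eq pR)) pnatX pnat_id // (pcharf_prime pR).
Qed.

Lemma frobenius_lin a u v i :
  (a *: u + v) ^+ (q ^ i) = a *: u ^+ (q ^ i) + v ^+ (q ^ i).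
Proof. by rewrite exprDn_pchar ?pchar_nat_exp // exprZn fix_k_iter. Qed.

Lemma frobenius_sub u v i : (u - v) ^+ (q ^ i) = u ^+ (q ^ i) - v ^+ (q ^ i).
Proof. by rewrite addrC -scaleN1r frobenius_lin scaleN1r addrC. Qed.

Lemma frobenius_trace_lin n a u v :
  frobenius_trace n (a *: u + v) = a *: frobenius_trace n u + frobenius_trace n v.
Proof.
rewrite scaler_sumr -big_split /=; apply: eq_bigr => i _.
exact: frobenius_lin.
Qed.

Lemma frobenius_trace0 n : frobenius_trace n 0 = 0.
Proof.
rewrite /frobenius_trace big1 // => i _.
by rewrite expr0n expn_eq0 eqn0Ngt frobenius_q_gt0.
Qed.

(** On the subfield with [q^m] elements the trace from degree [s m] is [s] times
    the trace from degree [m]. *)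
Lemma frobenius_trace_periodic m s u : u ^+ (q ^ m) = u ->
  frobenius_trace (s * m) u = frobenius_trace m u *+ s.
Proof.
move=> um; elim: s => [|s IHs]; first by rewrite /frobenius_trace big_ord0.
rewrite mulrS -IHs /frobenius_trace mulSn big_split_ord; congr (_ + _).
by apply: eq_bigr => i _; rewrite /= expnD exprM um.
Qed.

Lemma horner_alg_fixed w n (b : {poly k}) : w ^+ (q ^ n) = w ->
  horner_alg w b ^+ (q ^ n) = horner_alg w b.
Proof.
move=> wn; elim/poly_ind: b => [|b c IHb].
  by rewrite rmorph0 expr0n expn_eq0 eqn0Ngt frobenius_q_gt0.
have -> : b * 'X + c%:P = c *: 1 + b * 'X by rewrite alg_polyC addrC.
rewrite horner_algP frobenius_lin rmorphM /= horner_algX exprMn IHb wn.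
by rewrite rmorph1 expr1n.
Qed.

(** If [R] is the field with [q^n] elements, the second factor is [1] when [b] is
    fixed by the [q^m]-power map and [0] otherwise. In general it is an
    idempotent [e] with [(b^(q^m) - b) e = 0]. *)
Lemma subfield_part_fixed b m n : (1 < q ^ n)%N -> b ^+ (q ^ n) = b ->
  (b * (1 - (b ^+ (q ^ m) - b) ^+ (q ^ n).-1)) ^+ (q ^ m) =
  b * (1 - (b ^+ (q ^ m) - b) ^+ (q ^ n).-1).
Proof.
move=> N1 bN; set d := b ^+ (q ^ m) - b; set e := 1 - _.
have dN : d ^+ (q ^ n) = d by rewrite frobenius_sub exprAC bN.
have de : d * e = 0.
  by rewrite mulrBr mulr1 -exprS prednK ?(ltnW N1) // dN subrr.
have ee : e * e = e.
  rewrite {1}/e mulrBl mul1r -(prednK (_ : 0 < (q ^ n).-1)%N); last first.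
    by case: (q ^ n)%N N1 => [|[]].
  by rewrite exprSr -mulrA de mulr0 subr0.
have eX j : (0 < j)%N -> e ^+ j = e.
  by case: j => // j _; elim: j => [|j IHj]; rewrite ?expr1 // exprS IHj ee.
have q0 : (0 < q ^ m)%N.
  by rewrite expn_gt0 frobenius_q_gt0.
rewrite exprMn eX // -[b ^+ _](subrK b) mulrDl de add0r.
by [].
Qed.

End FrobeniusTrace.

Section Quotient.
Variables (k : fieldType) (p r : nat).
Hypotheses (pk : p \in [pchar k]) (fix_k : forall a : k, a ^+ (p ^ r) = a).
Local Notation q := (p ^ r)%N.
Hypothesis q1 : (1 < q)%N.

(** Its quotient ring stands in for the field with [q^n] elements: it is the
    product of fields of order [q^d] with [d] dividing [n], one for each monic
    irreducible divisor of degree [d] of this polynomial. *)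
Definition frobenius_poly n : {poly k} := 'X^(q ^ n) - 'X.
Local Notation R n := {poly %/ frobenius_poly n}.

Lemma quotient_exp_gt1 j : (0 < j)%N -> (1 < q ^ j)%N.
Proof. by move=> j0; rewrite -(exp1n j) ltn_exp2r. Qed.

Variable n : nat.
Hypothesis n0 : (0 < n)%N.

Lemma size_frobenius_poly : size (frobenius_poly n) = (q ^ n).+1.
Proof.
rewrite size_polyDl ?size_polyXn // size_polyN size_polyX ltnS.
exact: quotient_exp_gt1 n0.
Qed.

Lemma mk_monic_frobenius_poly : mk_monic (frobenius_poly n) = frobenius_poly n.
Proof.
rewrite /mk_monic size_frobenius_poly ltnS (ltnW (quotient_exp_gt1 n0)).
rewrite monicE lead_coefDl ?lead_coefXn ?eqxx //.
by rewrite size_polyN size_polyX size_polyXn ltnS (quotient_exp_gt1 n0).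
Qed.

Lemma quotient_fixed (b : R n) : b ^+ (q ^ n) = b.
Proof.
pose x : R n := in_qpoly (frobenius_poly n) 'X.
have xE : horner_alg x (frobenius_poly n) = 0.
  rewrite -(poly_alg_initial (in_qpoly (frobenius_poly n))).
  apply/val_eqP; rewrite /= -{1}mk_monic_frobenius_poly.
  by rewrite (Pdiv.RingMonic.rmodpp (monic_mk_monic _)).
have xn : x ^+ (q ^ n) = x.
  apply/eqP; rewrite -subr_eq0 -[X in _ == X]xE rmorphB rmorphXn /=.
  by rewrite horner_algX.
have -> : b = horner_alg x b.
  rewrite -(poly_alg_initial (in_qpoly (frobenius_poly n))).
  exact/val_inj/esym/in_qpoly_small/size_mk_monic.
exact: (horner_alg_fixed pk fix_k).
Qed.

(** The trace of the class of the variable is represented by a nonzero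
    polynomial of degree [q^(n-1)], less than the degree [q^n] of the
    modulus. *)
Lemma frobenius_trace_qX_neq0 :
  frobenius_trace p r n (in_qpoly (frobenius_poly n) 'X) != 0.
Proof.
have -> : frobenius_trace p r n (in_qpoly (frobenius_poly n) 'X) =
    in_qpoly (frobenius_poly n) (\sum_(i < n) 'X^(q ^ i)).
  by rewrite rmorph_sum; apply: eq_bigr => i _; rewrite rmorphXn.
apply/eqP => /(congr1 (@polyn _ _)); rewrite in_qpoly_small.
  move=> /polyP/(_ 1%N)/eqP; rewrite coef_sum coef0.
  case: n n0 => // n' _; rewrite big_ord_recl big1 => [|i _].
    by rewrite coefXn expn0 addr0 oner_eq0.
  by rewrite coefXn ltn_eqF // quotient_exp_gt1.
rewrite mk_monic_frobenius_poly size_frobenius_poly ltnS.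
apply: leq_trans (size_sum _ _ _) _; apply/bigmax_leqP => i _.
by rewrite size_polyXn ltn_exp2l.
Qed.

End Quotient.

Section TraceTspaces.
Variables (k : fieldType) (X : choiceType) (p r : nat).
Hypotheses (pk : p \in [pchar k]) (fix_k : forall a : k, a ^+ (p ^ r) = a).
Local Notation q := (p ^ r)%N.
Hypothesis q1 : (1 < q)%N.
Local Notation A := (freealg0 k X).
Local Notation R n := {poly %/ frobenius_poly k p r n}.

Definition trace_zero n : set A := [set f | forall phi : A -> R n,
  alg_hom phi -> frobenius_trace p r n (phi f) = 0].

Lemma trace_zero_Tspace n : Tspace (trace_zero n).
Proof.
split; first split.
- by move=> phi phiP; rewrite alg_hom0 // frobenius_trace0.
- move=> a u v Vu Vv phi phiP.
  by rewrite phiP.1 (frobenius_trace_lin pk fix_k) Vu // Vv // scaler0 addr0.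
- move=> f fP _ [u Vu <-] phi phiP.
  by apply: (Vu (phi \o f)); exact: alg_hom_endo.
Qed.

Variable x0 : X.
Local Notation x := (letter x0 : A).

Lemma letter_not_trace_zero n : (0 < n)%N -> ~ trace_zero n x.
Proof.
move=> n0 /(_ _ (free_eval_hom (fun=> in_qpoly _ 'X))); rewrite free_eval_letter.
by apply/eqP; exact: frobenius_trace_qX_neq0.
Qed.

(** Let [F] be the polynomial of [subfield_part_fixed]; on a field of order
    [q^(s m)] it is the identity on the subfield of order [q^m] and [0] off it.
    Then [T - F] vanishes on the quotient ring of index [m], while the
    trace of index [s m] of a value of [F] is [s] times the trace of index [m],
    that is [0] as [p] divides [s]. So [T] is a sum of two polynomials, one for
    each space. *)
Lemma trace_zero_span (M : set A) m s : (0 < m)%N -> (0 < s)%N -> (p %| s)%N ->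
  subspace M -> trace_zero m `<=` M -> trace_zero (s * m) `<=` M -> M x.
Proof.
move=> m0 s0 ps sM mM nM; set n := (s * m)%N in nM.
have n0 : (0 < n)%N by rewrite muln_gt0 s0.
pose F : {poly k} := 'X * (1 - ('X^(q ^ m) - 'X) ^+ (q ^ n).-1).
have F0 : F.[0] = 0 by rewrite hornerM hornerX mul0r.
have FE (R : comAlgType k) (b : R) :
    horner_alg b F = b * (1 - (b ^+ (q ^ m) - b) ^+ (q ^ n).-1).
  by rewrite rmorphM rmorphB rmorph1 rmorphXn rmorphB rmorphXn /= !horner_algX.
rewrite -(nupolyX x) -(subrK F 'X) nupolyD; apply: subspaceD => //.
  apply: mM => phi phiP.
  rewrite alg_hom_nupoly // ?hornerD ?hornerN ?F0 ?hornerX ?subr0 //.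
  rewrite rmorphB /= FE horner_algX (quotient_fixed pk fix_k q1 m0) subrr.
  rewrite expr0n -subn1 subn_eq0 leqNgt (quotient_exp_gt1 q1 n0) subr0 mulr1.
  by rewrite subrr frobenius_trace0.
apply: nM => phi phiP; rewrite alg_hom_nupoly // FE.
rewrite frobenius_trace_periodic; last first.
  apply: (subfield_part_fixed pk fix_k); first exact: quotient_exp_gt1.
  exact: quotient_fixed.
have pR : p \in [pchar {poly %/ frobenius_poly k p r n}] by rewrite pchar_lalg.
have [t ->] := dvdnP ps.
by rewrite mulrnA (mulrn_pchar pR).
Qed.

Lemma maximal_Tspace_above (V : set A) : Tspace V -> ~ V x ->
  exists M, maximal_Tspace M /\ V `<=` M.
Proof.
move=> VT Vx.
pose Q := [set M : set A | [/\ Tspace M, V `<=` M & ~ M x]].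
have [||M [[MT VM Mx] Mmax]] := @zorn_maximal _ Q V.
- by split.
- move=> F [B FB] FQ Ftot; split.
  + by apply: Tspace_bigcup => //; [exists B|move=> C /FQ[]].
  + by move=> u Vu; exists B => //; have [_ VB _] := FQ _ FB; exact: VB.
  + by move=> [C FC Cx]; have [] := FQ _ FC.
exists M; split=> //; split.
  by split=> // ME; apply: Mx; rewrite ME.
move=> N [NT Nn] MN; apply: Mmax => //; split=> //.
  exact: subset_trans MN.
by move=> Nx; apply: Nn; exact: Tspace_letter Nx.
Qed.

(** Choose a maximal T-space above [trace_zero (p ^ j)] for each [j]. No proper
    T-space contains two of the [trace_zero (p ^ j)], so the choices are
    distinct. *)
Lemma infinitely_many_maximal :
  infinite_set [set M : set A | maximal_Tspace M].
Proof.
have p1 : (1 < p)%N by rewrite prime_gt1 // (pcharf_prime pk).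
have pj j : (0 < p ^ j)%N by rewrite expn_gt0 ltnW.
have /choice[M MP] j : exists M, maximal_Tspace M /\ trace_zero (p ^ j) `<=` M.
  apply: maximal_Tspace_above; first exact: trace_zero_Tspace.
  exact: letter_not_trace_zero.
have Mlt i j : (i < j)%N -> M i <> M j.
  move=> ij Mij; have [[[MT Mn] _] Mi] := MP i; have [_ Mj] := MP j.
  apply: Mn; apply: (@Tspace_letter _ _ _ x0) => //.
  apply: (@trace_zero_span _ (p ^ i) (p ^ (j - i))) => //.
  - by rewrite -(prednK (_ : 0 < j - i)%N) ?subn_gt0 // expnS dvdn_mulr.
  - exact: MT.1.
  - by rewrite -expnD subnK ?(ltnW ij) // Mij.
move=> /(@finite_preimage _ _ _ M)-/(_ _) fin; apply: infinite_nat.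
have -> : [set: nat] = M @^-1` [set M | maximal_Tspace M].
  by apply/seteqP; split=> // j _; have [] := MP j.
apply: fin => i j _ _ Mij; apply/eqP; case: ltngtP => // ij.
  by have := Mlt _ _ ij.
by have := Mlt _ _ ij; rewrite Mij.
Qed.

End TraceTspaces.

(** * Maximal T-ideals and maximal T-spaces *)
Theorem theorem5p1 (k : fieldType) (X : choiceType) (X_neq0 : [set: X] !=set0)
    (Z T2 : set (freealg0 k X)) (ZP : is_Z Z) (T2P : is_T2 T2) :
  [/\ (* (i) *)
      [/\ maximal_Tideal Z,
          (infinite_set [set: k] -> maximum_Tideal Z)
        & forall (q : nat) (x : X), [set: k] #= `I_q ->
            let W0 := set_add T2 (Tideal_gen [set letter x - nuexp (letter x) q])
            in W0 <> Z /\
               forall M : set (freealg0 k X),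
                 maximal_Tideal M <-> M = Z \/ M = W0],
      (* (ii) *)
      (forall M : set (freealg0 k X), maximal_Tideal M -> maximal_Tspace M),
      (* (iii) *)
      (infinite_set [set: k] ->
         forall M : set (freealg0 k X), maximal_Tspace M <-> M = Z)
    & (* (iv) *)
      (finite_set [set: k] ->
         infinite_set [set M : set (freealg0 k X) | maximal_Tspace M])].
Proof.
have [x0 _] := X_neq0.
have ZE := is_Z_no_linear ZP.
have Zmax : maximal_Tspace Z by rewrite ZE; exact: no_linear_maximal x0.
have ZmaxI : maximal_Tideal Z.
  apply: maximal_Tideal_of_Tspace Zmax.
  by rewrite ZE; exact: no_linear_Tideal.
have Vmax : finite_set [set: k] -> maximal_Tspace (@vanishing k X).
  move=> fink.
  have [p [r [cs [_ q1 fix_k [csu csT _] _]]]] := finite_field_data fink.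
  exact: (vanishing_maximal x0 q1 fix_k csu csT).
have inZ N : infinite_set [set: k] -> proper_among (@Tspace k _) N -> N `<=` Z.
  move=> infk [NT Nn] f Nf; rewrite ZE; apply: contrapT => Lf; apply: Nn.
  exact: (Tspace_letter NT (Tspace_infinite x0 infk NT Nf Lf)).
have dichotomy M : maximal_Tideal M -> M `<=` Z \/ M `<=` @vanishing k X.
  move=> [[MI Mn] _]; have [LM|LM] := pselect (M `<=` Z); first by left.
  right=> g Mg; apply: contrapT => Vg; apply: LM => f Mf; rewrite ZE.
  apply: contrapT => Lf; apply: Mn.
  exact: (Tspace_letter MI.1 (Tideal_dichotomy x0 MI Mf Lf Mg Vg)).
have dichotomyE M : finite_set [set: k] -> maximal_Tideal M ->
    M = Z \/ M = @vanishing k X.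
  move=> fink Mmax; have [MZ|MV] := dichotomy M Mmax.
    by left; apply/esym/Mmax.2 => //; exact: ZmaxI.1.
  right; apply/esym/Mmax.2 => //.
  exact: (maximal_Tideal_of_Tspace (vanishing_Tideal k X) (Vmax fink)).1.
split.
- split=> //.
  + by move=> infk; split; [exact: ZmaxI.1 | move=> N [[NT _] Nn]; exact: inZ].
  + move=> q x kq W0.
    have fink : finite_set [set: k] by exists q.
    have [p [r [cs [_ q1 fix_k [_ _ kpr] csE]]]] := finite_field_data fink.
    have qE : (p ^ r)%N = q.
      by apply/card_eq_II/(card_eq_trans _ kq); rewrite card_eq_sym.
    rewrite qE in q1 fix_k csE.
    have W0E : W0 = @vanishing k X := W0_vanishing x q1 fix_k csE T2P.
    rewrite W0E; split=> [VZ|M].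
      have : @vanishing k X (letter x0 ** letter x0).
        by rewrite VZ ZE; exact: no_linear_mul.
      apply: (not_vanishing (free_eval_hom (fun=> 1))).
      by rewrite alg_homM ?free_eval_letter ?mulr1 ?oner_eq0 //; exact: free_eval_hom.
    split; first exact: dichotomyE.
    case=> ->; first exact: ZmaxI.
    exact: (maximal_Tideal_of_Tspace (vanishing_Tideal k X) (Vmax fink)).
- move=> M Mmax; have [fink|infk] := pselect (finite_set [set: k]).
    by have [->|->] := dichotomyE M fink Mmax; [exact: Zmax|exact: Vmax].
  suff -> : M = Z by [].
  apply/esym/Mmax.2; first exact: ZmaxI.1.
  by apply: inZ => //; have [[[]]] := Mmax.
- move=> infk M; split=> [Mmax|->//].
  by apply/esym/Mmax.2; [exact: Zmax.1|exact: inZ infk Mmax.1].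
- move=> fink; have [p [r [cs [pk q1 fix_k _ _]]]] := finite_field_data fink.
  exact: infinitely_many_maximal pk fix_k q1 x0.
Qed.
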